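(* Let $n\geq 4$ be an integer. (i) If $n$ is odd, then \[ q(F_n)=\frac{n+2+\sqrt{(n-2)^2+8}}{2}, \] and $q(F_n)$ satisfies \[ n+\frac{2}{n-1}<q(F_n)<n+\frac{2}{n-2}. \] (ii) If $n$ is even, then $q(F_n)$ is the largest root of the equation \[ x^3-(n+3)x^2+3nx-2n+4=0, \] and $q(F_n)$ satisfies \[ n+\frac{2}{n}<q(F_n)<n+\frac{2}{n-1}. \]
   Context: Graphs are finite, simple and undirected. For a graph $G$, the signless Laplacian is $Q(G)=D(G)+A(G)$, where $D(G)$ is the diagonal matrix of vertex degrees and $A(G)$ is the adjacency matrix; $q(G)$ denotes the largest eigenvalue of $Q(G)$. For odd $n$, $F_n$ is the friendship graph of order $n$: the union of $\lfloor n/2\rfloor$ triangles sharing a single common vertex (and otherwise disjoint). For even $n$, $F_n$ is obtained from $F_{n-1}$ by adding one new vertex joined only to the common vertex (center) of $F_{n-1}$. *)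

(* Defs.v *)
From HB Require Import structures.
From mathcomp Require Import all_boot all_order all_algebra.
From mathcomp Require Import boolp classical_sets reals.
From mathcomp Require complex polyrcf.

Set Implicit Arguments.
Unset Strict Implicit.
Unset Printing Implicit Defensive.

Import Order.TTheory GRing.Theory Num.Theory.

Local Open Scope ring_scope.

Record sgraph := SGraph {
  vertex :> finType;
  adj : rel vertex;
  adj_sym : symmetric adj;
  adj_irr : irreflexive adj }.

Section SignlessLaplacian.
Variables (R : realType) (G : sgraph).

Definition degree (v : G) : nat := #|[set w | adj v w]|.

(* Matrices are indexed by 'I_#|G|, vertices being listed by enum_val. *)
Definition adjacency_mx : 'M[R]_#|G| :=
  \matrix_(i, j) (adj (enum_val i) (enum_val j))%:R.

Definition degree_mx : 'M[R]_#|G| :=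
  diag_mx (\row_i (degree (enum_val i))%:R).

Definition signless_laplacian : 'M[R]_#|G| := degree_mx + adjacency_mx.

End SignlessLaplacian.

(* Total as a supremum, which is a maximum for symmetric matrices of positive
   size: see [largest_eigenvalueP] and [signless_radiusP]. *)
Definition largest_eigenvalue (R : realType) n (M : 'M[R]_n) : R :=
  sup [set a | eigenvalue M a]%classic.

Definition signless_radius (R : realType) (G : sgraph) : R :=
  largest_eigenvalue (signless_laplacian R G).

Section Friendship.

(* [k] triangles sharing the vertex [None]; the [i]-th one is
   [None], [Some (i, false)], [Some (i, true)]. *)
Definition windmill_adj k : rel (option ('I_k * bool)) := fun u v =>
  match u, v with
  | None, None => false
  | None, Some _ | Some _, None => true
  | Some (i, a), Some (j, b) => (i == j) && (a != b)
  end.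

Lemma windmill_sym k : symmetric (@windmill_adj k).
Proof. by move=> [[i a]|] [[j b]|] //=; rewrite eq_sym (eq_sym a). Qed.

Lemma windmill_irr k : irreflexive (@windmill_adj k).
Proof. by move=> [[i a]|] //=; rewrite !eqxx. Qed.

Definition windmill k : sgraph := SGraph (@windmill_sym k) (@windmill_irr k).

Definition pendant_adj (G : sgraph) (c : G) : rel (option G) := fun u v =>
  match u, v with
  | Some x, Some y => adj x y
  | Some x, None | None, Some x => x == c
  | None, None => false
  end.

Lemma pendant_sym (G : sgraph) (c : G) : symmetric (pendant_adj c).
Proof. by move=> [x|] [y|] //=; exact: adj_sym. Qed.

Lemma pendant_irr (G : sgraph) (c : G) : irreflexive (pendant_adj c).
Proof. by move=> [x|] //=; exact: adj_irr. Qed.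

Definition add_pendant (G : sgraph) (c : G) : sgraph :=
  SGraph (pendant_sym c) (pendant_irr c).

Definition friendship (n : nat) : sgraph :=
  if odd n then windmill n./2
  else @add_pendant (windmill n.-1./2) None.

Lemma card_friendship n : (0 < n)%N -> #|friendship n| = n.
Proof.
move=> n0; rewrite /friendship; case: ifPn => [n_odd|n_even].
  rewrite card_option card_prod card_ord card_bool muln2.
  by rewrite -[RHS]odd_double_half n_odd.
have o : odd n.-1 by move: n_even; rewrite -{1}(prednK n0) /= negbK.
rewrite !card_option card_prod card_ord card_bool muln2.
by rewrite -[in RHS](prednK n0) -[in RHS](odd_double_half n.-1) o.
Qed.

End Friendship.

Section LargestEigenvalue.
Import complex.
Variable R : realType.

Lemma symmetric_eigenvalue n (M : 'M[R]_n) :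
  (0 < n)%N -> M^T = M -> exists a, eigenvalue M a.
Proof.
move=> n0 symM; pose f : {rmorphism R -> complex R} := real_complex R.
pose A : 'M[complex R]_n := map_mx f M.
have [l /eigenvalueP[v vA v0]] : exists l, eigenvalue A l.
  have /closed_rootP[l rl] : size (char_poly A) != 1.
    by rewrite size_char_poly eqSS -lt0n.
  by exists l; rewrite eigenvalue_root_char.
pose w := map_mx Num.conj v^T.
have Aconj : map_mx Num.conj A^T = A.
  apply/matrixP => i j; rewrite !mxE -[in RHS]symM mxE.
  exact: conjc_real.
have Aw : A *m w = l^* *: w.
  rewrite -[in LHS]Aconj -map_mxM -trmx_mul vA linearZ /= .
  by apply/matrixP => i j; rewrite !mxE rmorphM.
have vw : (v *m w) 0 0 != 0.
  rewrite mxE gt_eqF // lt_neqAle eq_sym; apply/andP; split; last first.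
    by apply: sumr_ge0 => i _; rewrite !mxE mul_conjC_ge0.
  apply: contra v0 => /eqP s0; apply/eqP/rowP => i; rewrite mxE.
  have /psumr_eq0P := s0 => /(_ _ i isT) /=.
  rewrite !mxE => H; apply/eqP; rewrite -mul_conjC_eq0; apply/eqP/H.
  by move=> j _; rewrite !mxE mul_conjC_ge0.
have ll : l^* = l.
  apply: (mulIf vw).
  have : v *m A *m w = v *m (A *m w) by rewrite mulmxA.
  rewrite vA Aw -scalemxAl -scalemxAr => /matrixP/(_ 0 0).
  by rewrite !mxE.
have [r lr] : exists r, l = f r.
  by apply/complex_realP; rewrite CrealE ll.
exists r; rewrite -(eigenvalue_map f) -lr.
by apply/eigenvalueP; exists v.
Qed.

Lemma largest_eigenvalueP n (M : 'M[R]_n) : (0 < n)%N -> M^T = M ->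
  eigenvalue M (largest_eigenvalue M) /\
  forall a, eigenvalue M a -> a <= largest_eigenvalue M.
Proof.
move=> n0 symM; have [a0 ea0] := symmetric_eigenvalue n0 symM.
have p0 : char_poly M != 0 by rewrite -size_poly_eq0 size_char_poly.
have max_in (s : seq R) a : a \in s ->
    exists2 b, b \in s & {in s, forall c, c <= b}.
  elim: s a => // x s IH a _; case: s IH => [|y s] IH.
    by exists x; rewrite ?mem_head // => c; rewrite inE => /eqP ->.
  have [b bs bmax] := IH y (mem_head _ _).
  have [xb|bx] := leP x b.
    exists b; first by rewrite in_cons bs orbT.
    by move=> c; rewrite in_cons => /orP[/eqP->|/bmax].
  exists x; first exact: mem_head.
  move=> c; rewrite in_cons => /orP[/eqP->//|/bmax cb].
  exact: le_trans cb (ltW bx).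
pose s := polyrcf.rootsR (char_poly M).
have sE a : (a \in s) = eigenvalue M a.
  by rewrite -(polyrcf.roots_on_rootsR p0) in_itv eigenvalue_root_char.
have [b bs bmax] : exists2 b, b \in s & {in s, forall c, c <= b}.
  by apply: (max_in s a0); rewrite sE.
have bub a : eigenvalue M a -> a <= b by rewrite -sE => /bmax.
have -> : largest_eigenvalue M = b.
  apply/eqP; rewrite eq_le; apply/andP; split.
    by apply: ge_sup => [|a /= /bub]; first by exists a0.
  by apply: ub_le_sup; [exists b => a /= /bub | rewrite /= -sE].
by rewrite -sE.
Qed.

Lemma signless_laplacian_sym (G : sgraph) :
  (signless_laplacian R G)^T = signless_laplacian R G.
Proof.
rewrite /signless_laplacian linearD /= tr_diag_mx.
by congr (_ + _); apply/matrixP => i j; rewrite !mxE adj_sym.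
Qed.

Lemma signless_radiusP (G : sgraph) : (0 < #|G|)%N ->
  eigenvalue (signless_laplacian R G) (signless_radius R G) /\
  forall a, eigenvalue (signless_laplacian R G) a -> a <= signless_radius R G.
Proof.
by move=> G0; apply: largest_eigenvalueP => //; exact: signless_laplacian_sym.
Qed.

End LargestEigenvalue.

(* Main.v *)
Require Import Defs.
From mathcomp Require Import all_boot all_order all_algebra.
From mathcomp Require Import reals.
From mathcomp Require Import ring lra.

Import Order.TTheory GRing.Theory Num.Theory.
Local Open Scope ring_scope.

(** An eigenvector of the signless Laplacian for the eigenvalue [a] is a nonzero
    function [f] on the vertices with [sum_(w ~ v) (f v + f w) = a * f v] for
    every [v].  Let [a] differ from 1 and 3.  On a triangle of the windmill with
    rim values [x], [y] and central value [c], subtracting the two rim equations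
    gives [(a - 1) * (x - y) = 0], hence [x = y], and then each of them reads
    [(a - 3) * x = c].  All the rim values are thus fixed by [c], as is the
    value [l] at the pendant vertex, by [(a - 1) * l = c].  So [c] is nonzero,
    and what is left of the eigenvalue problem is the equation at the center: a
    polynomial equation in [a], quadratic for odd [n] and cubic for even [n]
    ([eigenvalue_windmill], [eigenvalue_pendant_windmill]).  Conversely, each of
    its solutions comes with an explicit eigenvector.

    The exceptional values 1 and 3 are too small to matter: in both cases the
    equation has a root above [n], given by the quadratic formula or by the
    intermediate value theorem ([even_cubic_root]).  The spectral radius is
    therefore above 3, hence is itself a root, and it is the largest one.  The
    two bounds then come from the sign of the polynomial at their end points. *)

(** * Eigenfunctions of the signless Laplacian *)

Definition signless_op (R : realType) (G : sgraph) (f : G -> R) (v : G) : R :=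
  \sum_(w | adj v w) (f v + f w).

Arguments signless_op {R G} f v.

(** The number of summands at [v] is the degree of [v], so that the terms [f v]
    make up the degree matrix and the terms [f w] the adjacency matrix; row
    vectors may be used because the adjacency relation is symmetric. *)
Lemma signless_op_mxE (R : realType) (G : sgraph) (u : 'rV[R]_#|G|) i :
  (u *m signless_laplacian R G) 0 i =
  signless_op (fun v => u 0 (enum_rank v)) (enum_val i).
Proof.
rewrite /signless_laplacian mulmxDr mul_mx_diag !mxE /signless_op big_split /=.
congr (_ + _).
  rewrite sumr_const enum_valK mulr_natr; congr (_ *+ _).
  by rewrite /degree cardsE.
rewrite [RHS]big_mkcond [RHS](reindex _ (onW_bij _ (enum_val_bij G))) /=.
apply: eq_bigr => j _; rewrite mxE adj_sym enum_valK.
by case: adj; rewrite ?mulr1 ?mulr0.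
Qed.

Lemma eigenvalue_signlessP (R : realType) (G : sgraph) (a : R) :
  eigenvalue (signless_laplacian R G) a <->
  exists2 f : G -> R, (exists v, f v != 0) &
    forall v, signless_op f v = a * f v.
Proof.
split=> [/eigenvalueP[u uQ u0]|[f [v fv0] fQ]].
  exists (fun v => u 0 (enum_rank v)).
    by have /rV0Pn[i ui] := u0; exists (enum_val i); rewrite enum_valK.
  by move=> v; rewrite -[v in LHS]enum_rankK -signless_op_mxE uQ mxE.
apply/eigenvalueP; exists (\row_i f (enum_val i)).
  apply/rowP => i; rewrite signless_op_mxE !mxE -fQ /signless_op.
  by apply: eq_bigr => w _; rewrite !mxE !enum_rankK.
by apply/rV0Pn; exists (enum_rank v); rewrite mxE enum_rankK.
Qed.

(** * The windmill *)

Lemma sum_option (V : nmodType) (T : finType) (P : pred (option T))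
    (F : option T -> V) :
  \sum_(u | P u) F u =
  (if P None then F None else 0) + \sum_(x | P (Some x)) F (Some x).
Proof.
rewrite big_mkcond (bigD1 None) //=; congr (_ + _).
rewrite (reindex_omap Some id) => [|[x|] //].
by rewrite /= -[LHS]big_mkcondr; apply: eq_bigl => x; rewrite eqxx.
Qed.

Lemma signless_op_center (R : realType) k (f : windmill k -> R) :
  signless_op f None = \sum_(p : 'I_k * bool) (f None + f (Some p)).
Proof. by rewrite /signless_op sum_option /= add0r. Qed.

Lemma signless_op_rim (R : realType) k (f : windmill k -> R) i b :
  signless_op f (Some (i, b)) =
  f (Some (i, b)) + f None + (f (Some (i, b)) + f (Some (i, ~~ b))).
Proof.
rewrite /signless_op sum_option /=; congr (_ + _).
rewrite (big_pred1 (i, ~~ b)) // => -[j c] /=.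
by rewrite [RHS]xpair_eqE [i == j]eq_sym; case: b; case: c.
Qed.

(** The two equations of a triangle have a difference that forces its rim values
    to agree when [a != 1].  Only the rim equations are assumed: the equation at
    the center changes when a pendant vertex is attached there. *)
Lemma windmill_rim_eq (R : realType) k (f : windmill k -> R) (a : R) :
    a != 1 -> (forall p, signless_op f (Some p) = a * f (Some p)) ->
  forall p, (a - 3) * f (Some p) = f None.
Proof.
move=> a1 fQ [i b]; have := fQ (i, b); have := fQ (i, ~~ b).
rewrite !signless_op_rim negbK.
move: (f (Some (i, b))) (f (Some (i, ~~ b))) (f None) => x y c ey ex.
have xy : x = y.
  by apply: (@mulfI _ (a - 1)); rewrite ?subr_eq0 //; lra.
by lra.
Qed.

(** Multiplying by [a - 3] turns each of the [2k] summands [f None + f (Some p)]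
    into [(a - 3) * f None + f None], whence the factor [a - 2]. *)
Lemma windmill_center_eq (R : realType) k (f : windmill k -> R) (a : R) :
    (forall p, (a - 3) * f (Some p) = f None) ->
  (a - 3) * signless_op f None = k.*2%:R * (a - 2) * f None.
Proof.
move=> fE; rewrite signless_op_center mulr_sumr.
under eq_bigr => p _ do rewrite mulrDr fE.
rewrite sumr_const card_prod card_ord card_bool muln2 -mulr_natl; ring.
Qed.

(** Converse of [windmill_rim_eq], used to build eigenvectors that are constant
    on the rim; the scale [s] is left free so that values at the other vertices
    can be polynomials in [a]. *)
Lemma windmill_radial_rim (R : realType) k (f : windmill k -> R) (a s : R) :
    f None = (a - 3) * s -> (forall p, f (Some p) = s) ->
  forall p, signless_op f (Some p) = a * f (Some p).
Proof. by move=> f0 fs [i b]; rewrite signless_op_rim !fs f0; ring. Qed.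

(** An eigenvector cannot vanish at the center, since the rim values are
    determined by the central one; cancelling that value from the equation at
    the center leaves the condition on [a]. *)
Lemma eigenvalue_windmill (R : realType) k (a : R) : a != 1 -> a != 3 ->
  eigenvalue (signless_laplacian R (windmill k)) a <->
  a * (a - 3) = k.*2%:R * (a - 2).
Proof.
move=> a1 a3; have a3' : a - 3 != 0 by rewrite subr_eq0.
split=> [/eigenvalue_signlessP[f [v fv] fQ]|aE].
  have fE := windmill_rim_eq R k f a a1 (fun p => fQ (Some p)).
  have := windmill_center_eq R k f a fE; rewrite fQ mulrCA mulrA => cE.
  apply: (mulIf _ cE); apply: contra fv; case: v => [p|//].
  by rewrite -(fE p) mulf_eq0 (negPf a3').
apply/eigenvalue_signlessP.
pose f (v : windmill k) : R := if v is None then a - 3 else 1.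
have fQ := windmill_radial_rim R k f a 1 (esym (mulr1 _)) (fun=> erefl).
exists f; first by exists None.
move=> [p|]; first exact: fQ.
apply: (mulfI a3'); rewrite windmill_center_eq => [|p]; last by rewrite mulr1.
by rewrite -aE mulrC mulrA.
Qed.

(** * The windmill with a pendant vertex *)

Lemma signless_op_pendant_leaf (R : realType) (G : sgraph) (c : G)
    (f : add_pendant c -> R) :
  signless_op f None = f None + f (Some c).
Proof.
by rewrite /signless_op sum_option /= add0r (big_pred1 c).
Qed.

Lemma signless_op_pendant_Some (R : realType) (G : sgraph) (c : G)
    (f : add_pendant c -> R) v :
  signless_op f (Some v) =
  (if v == c then f (Some v) + f None else 0) + signless_op (f \o Some) v.
Proof. by rewrite /signless_op sum_option. Qed.

(** The same elimination as for [eigenvalue_windmill], with one more value tied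
    to the central one: the leaf value is the central value over [a - 1]. *)
Lemma eigenvalue_pendant_windmill (R : realType) k (a : R) :
    a != 1 -> a != 3 ->
  eigenvalue (signless_laplacian R (@add_pendant (windmill k) None)) a <->
  a * (a - 3) * (a - 1) = k.*2%:R * (a - 2) * (a - 1) + a * (a - 3).
Proof.
move=> a1 a3; have a3' : a - 3 != 0 by rewrite subr_eq0.
have a1' : a - 1 != 0 by rewrite subr_eq0.
split=> [/eigenvalue_signlessP[f [v fv] fQ]|aE].
  have fp p : signless_op (f \o Some) (Some p) = a * (f \o Some) (Some p).
    by rewrite -fQ signless_op_pendant_Some add0r.
  have fE := windmill_rim_eq R k _ a a1 fp.
  have := windmill_center_eq R k _ a fE.
  have := fQ (Some None); rewrite signless_op_pendant_Some /=.
  have := fQ None; rewrite signless_op_pendant_leaf.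
  move: (signless_op _ _) => S lE cE SE.
  have c0 : f (Some None) != 0.
    apply: contra fv => /eqP c0; apply/eqP; case: v => [[p|//]|].
      by apply: (mulfI a3'); rewrite [LHS](fE p) /= c0 mulr0.
    by apply: (mulfI a1'); rewrite mulr0; lra.
  have {}lE : (a - 1) * f None = f (Some None) by lra.
  (* The equation at the center, times the two denominators [a - 3] and
     [a - 1]. *)
  apply: (mulIf c0).
  move: c0 SE cE lE; move: (f None) (f (Some None)) => l c _ SE cE lE.
  transitivity ((a - 3) * (a - 1) * (a * c)); first ring.
  rewrite -cE; transitivity ((a - 3) * ((a - 1) * c + (a - 1) * l) +
    (a - 1) * ((a - 3) * S)); first ring.
  rewrite lE SE; ring.
apply/eigenvalue_signlessP.
(* Central value [(a - 3) * (a - 1)], divided by [a - 3] on the rim and by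
   [a - 1] at the leaf. *)
pose f (v : add_pendant (None : windmill k)) : R :=
  match v with
  | None => a - 3
  | Some None => (a - 3) * (a - 1)
  | Some (Some _) => a - 1
  end.
have fp := windmill_radial_rim R k (f \o Some) a (a - 1) erefl (fun=> erefl).
exists f; first by exists None.
move=> [[p|]|].
- by rewrite signless_op_pendant_Some add0r; exact: fp.
- rewrite signless_op_pendant_Some; apply: (mulfI a3').
  rewrite mulrDr windmill_center_eq //= .
  transitivity ((a - 3) * (k.*2%:R * (a - 2) * (a - 1) + a * (a - 3))).
    ring.
  rewrite -aE; ring.
- rewrite signless_op_pendant_leaf /=; ring.
Qed.

(** * The characteristic equations of friendship graphs *)

Lemma friendship_oddP (R : realType) n (a : R) :
    (4 <= n)%N -> odd n -> 3 < a ->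
  eigenvalue (signless_laplacian R (friendship n)) a <->
  a ^+ 2 - (n%:R + 2) * a + 2 * (n%:R - 1) = 0.
Proof.
move=> n4 n_odd a3; rewrite /friendship n_odd.
have nE : n = n./2.*2.+1 by rewrite -[LHS]odd_double_half n_odd.
have -> : n%:R = n./2.*2%:R + 1 :> R by rewrite [in LHS]nE -natr1.
have a1 : a != 1 by apply/eqP; lra.
have a3' : a != 3 by apply/eqP; lra.
by apply: (iff_trans (eigenvalue_windmill _ _ _ a1 a3')); split; lra.
Qed.

Lemma friendship_evenP (R : realType) n (a : R) :
    (4 <= n)%N -> ~~ odd n -> 3 < a ->
  eigenvalue (signless_laplacian R (friendship n)) a <->
  a ^+ 3 - (n%:R + 3) * a ^+ 2 + 3 * n%:R * a - 2 * n%:R + 4 = 0.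
Proof.
move=> n4 n_even a3; rewrite /friendship (negPf n_even).
have nE : n = n.-1./2.*2.+2.
  case: n n4 n_even => // m _; rewrite /= negbK => m_odd.
  by rewrite -[in LHS](odd_double_half m) m_odd.
have -> : n%:R = n.-1./2.*2%:R + 2 :> R by rewrite [in LHS]nE -addn2 natrD.
have a1 : a != 1 by apply/eqP; lra.
have a3' : a != 3 by apply/eqP; lra.
by apply: (iff_trans (eigenvalue_pendant_windmill _ _ _ a1 a3')); split; lra.
Qed.

(** * Location of the largest roots *)

(** Put [s] for the square root.  With [t] the fraction in a bound, the
    comparison is that of [s] with [N - 2 + 2 * t], whose square exceeds
    [(N - 2) ^+ 2] by [4 * t * (N - 2 + t)].  For [t = 2 / (N - 2)] this is
    [8 + 4 * t ^+ 2 > 8]; for [t = 2 / (N - 1)] it is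
    [8 - 4 * t * (1 - t) < 8], as [t < 1]. *)
Lemma odd_bounds (R : rcfType) (N : R) : 4 <= N ->
  let r := (N + 2 + Num.sqrt ((N - 2) ^+ 2 + 8)) / 2 in
  N + 2 / (N - 1) < r /\ r < N + 2 / (N - 2).
Proof.
move=> N4 r; rewrite /r; set s := Num.sqrt _.
have s0 : 0 <= s by apply: sqrtr_ge0.
have s2 : s ^+ 2 = (N - 2) ^+ 2 + 8.
  by rewrite sqr_sqrtr // addr_ge0 ?sqr_ge0 ?ler0n.
split.
  have t0 : 0 < 2 / (N - 1) by apply: divr_gt0; lra.
  have tE : (N - 1) * (2 / (N - 1)) = 2 by field; lra.
  move: (2 / (N - 1)) t0 tE => t t0 tE.
  suff : N - 2 + 2 * t < s by lra.
  rewrite -(ltr_pXn2r (n := 2)) ?nnegrE //; last lra.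
  by rewrite s2; nra.
have t0 : 0 < 2 / (N - 2) by apply: divr_gt0; lra.
have tE : (N - 2) * (2 / (N - 2)) = 2 by field; lra.
move: (2 / (N - 2)) t0 tE => t t0 tE.
suff : s < N - 2 + 2 * t by lra.
rewrite -(ltr_pXn2r (n := 2)) ?nnegrE //; last lra.
by rewrite s2; nra.
Qed.

Definition even_cubic (R : rcfType) (N x : R) : R :=
  x ^+ 3 - (N + 3) * x ^+ 2 + 3 * N * x - 2 * N + 4.

Arguments even_cubic {R} N x.

Lemma even_cubic_lower (R : rcfType) (N : R) : 4 <= N ->
  even_cubic N (N + 2 / N) < 0.
Proof.
move=> N4.
have -> : even_cubic N (N + 2 / N) =
    - (2 * N ^+ 2 * (N - 4) + 12 * N - 8) / N ^+ 3.
  by rewrite /even_cubic; field; lra.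
rewrite mulNr oppr_lt0 divr_gt0 ?exprn_gt0 //; last lra.
have : 0 <= 2 * N ^+ 2 * (N - 4).
  by rewrite mulr_ge0 ?mulr_ge0 ?sqr_ge0 //; lra.
lra.
Qed.

(** At the bound [u] the cubic is positive, and so are its first and second
    derivatives; the Taylor expansion at [u] gives positivity beyond. *)
Lemma even_cubic_upper (R : rcfType) (N x : R) : 4 <= N ->
  N + 2 / (N - 1) <= x -> 0 < even_cubic N x.
Proof.
move=> N4.
set u := N + _ => ux.
have uN : N <= u.
  by rewrite lerDl divr_ge0; lra.
have pu : 0 < even_cubic N u.
  have -> : even_cubic N u = (4 * (N - 1) * (N - 2) + 8) / (N - 1) ^+ 3.
    by rewrite /even_cubic /u; field; lra.
  by rewrite divr_gt0 ?exprn_gt0 //; nra.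
have -> : even_cubic N x = even_cubic N u +
    (x - u) * (3 * u ^+ 2 - 2 * (N + 3) * u + 3 * N) +
    (x - u) ^+ 2 * (3 * u - (N + 3)) + (x - u) ^+ 3.
  rewrite /even_cubic; ring.
have d0 : 0 <= x - u by lra.
have d1 : 0 <= 3 * u ^+ 2 - 2 * (N + 3) * u + 3 * N.
  have -> : 3 * u ^+ 2 - 2 * (N + 3) * u + 3 * N =
      N * (N - 3) + (4 * N - 6) * (u - N) + 3 * (u - N) ^+ 2 by ring.
  by rewrite !addr_ge0 ?mulr_ge0 ?sqr_ge0 //; lra.
have d2 : 0 <= 3 * u - (N + 3) by lra.
by do 3![apply: ltr_wpDr; first by rewrite ?mulr_ge0 ?exprn_ge0].
Qed.

Lemma even_cubic_root (R : rcfType) (N : R) : 4 <= N ->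
  exists2 x, N + 2 / N <= x & even_cubic N x = 0.
Proof.
move=> N4.
pose p : {poly R} :=
  'X^3 - (N + 3)%:P * 'X^2 + (3 * N)%:P * 'X - (2 * N)%:P + 4%:P.
have pE x : p.[x] = even_cubic N x by rewrite /p /even_cubic !hornerE; ring.
have lo := even_cubic_lower R N N4.
have hi := even_cubic_upper R N _ N4 (lexx _).
have le_bounds : N + 2 / N <= N + 2 / (N - 1).
  by rewrite lerD2l ler_pM2l // lef_pV2 ?posrE; lra.
have [|x /andP[lx _] /eqP px] := @poly_ivt _ p _ _ le_bounds.
  by rewrite !pE !ltW.
by exists x; rewrite // -pE.
Qed.

Theorem proposition2 (R : realType) (n : nat) (hn : (4 <= n)%N) :
  (odd n ->
     signless_radius R (friendship n) =
       (n%:R + 2 + Num.sqrt ((n%:R - 2) ^+ 2 + 8)) / 2 /\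
     n%:R + 2 / (n%:R - 1) < signless_radius R (friendship n) /\
     signless_radius R (friendship n) < n%:R + 2 / (n%:R - 2)) /\
  (~~ odd n ->
     (let is_root (x : R) :=
        x ^+ 3 - (n%:R + 3) * x ^+ 2 + 3 * n%:R * x - 2 * n%:R + 4 = 0 in
      is_root (signless_radius R (friendship n)) /\
      (forall x : R, is_root x -> x <= signless_radius R (friendship n))) /\
     n%:R + 2 / n%:R < signless_radius R (friendship n) /\
     signless_radius R (friendship n) < n%:R + 2 / (n%:R - 1)).
Proof.
have N4 : 4 <= n%:R :> R by rewrite ler_nat.
have [|rQ r_max] := @signless_radiusP R (friendship n).
  by rewrite card_friendship; apply: leq_trans hn.
move: (signless_radius R _) rQ r_max => r rQ r_max.
split=> [n_odd|n_even].
  have [lo hi] := odd_bounds R n%:R N4.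
  have s2 : Num.sqrt ((n%:R - 2) ^+ 2 + 8) ^+ 2 = (n%:R - 2) ^+ 2 + 8 :> R.
    by rewrite sqr_sqrtr // addr_ge0 ?sqr_ge0 ?ler0n.
  have s0 : 0 <= Num.sqrt ((n%:R - 2) ^+ 2 + 8) :> R by apply: sqrtr_ge0.
  suff -> : r = (n%:R + 2 + Num.sqrt ((n%:R - 2) ^+ 2 + 8)) / 2 by [].
  move: (Num.sqrt _) s2 s0 {lo hi} => s s2 s0.
  have s_large : 2 <= s by nra.
  have le_r : (n%:R + 2 + s) / 2 <= r.
    apply: r_max; apply/friendship_oddP => //; first lra.
    by lra.
  have r3 : 3 < r by lra.
  have rE := (friendship_oddP R n r hn n_odd r3).1 rQ.
  apply/eqP; rewrite eq_le le_r andbT leNgt; apply/negP => lt_r.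
  (* A value beyond the larger root is beyond both, so that the quadratic is
     positive there. *)
  have : 0 < (r - (n%:R + 2 + s) / 2) * (r - (n%:R + 2 - s) / 2).
    by rewrite mulr_gt0 //; lra.
  lra.
have [x0 lo0 x0E] := even_cubic_root R n%:R N4.
have t0 : 0 < 2 / n%:R :> R by rewrite divr_gt0; lra.
have x0_le : x0 <= r by apply: r_max; apply/friendship_evenP => //; lra.
have root_le x : even_cubic n%:R x = 0 -> x <= r.
  move=> x_root; have [x3|x3] := lerP x 3; first lra.
  by apply: r_max; apply/friendship_evenP.
have rE : even_cubic n%:R r = 0 by apply/friendship_evenP => //; lra.
split; first by split.
split.
  rewrite lt_neqAle (le_trans lo0 x0_le) andbT; apply/eqP => r_lo.
  by have := even_cubic_lower R n%:R N4; rewrite r_lo rE ltxx.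
rewrite ltNge; apply/negP => /(even_cubic_upper R n%:R r N4).
by rewrite rE ltxx.
Qed.
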